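(* For any non-empty graph $G$, we have $\sigma(G)=\sigma\left(K_{\chi(G)}\right)$, where $\sigma$ denotes the orientation covering number, $\chi(G)$ is the chromatic number of $G$, and $K_m$ is the complete graph on $m$ vertices.
   Context: Graphs are finite, simple and undirected; a graph is non-empty if it has at least one vertex. An orientation of a graph $G$ assigns to every edge $xy\in E(G)$ exactly one of the two directions $(x,y)$ (oriented from $x$ to $y$, i.e. away from $x$) or $(y,x)$. Given a non-empty graph $G$ and $k$ orientations $\vec{G}_1,\dots,\vec{G}_k$ of $G$, we say that $\vec{G}_1,\dots,\vec{G}_k$ is an orientation covering of $G$ if whenever $x,y,z\in V(G)$ with $xy,xz\in E(G)$ ($y=z$ is allowed), there is some $i$ such that $(x,y),(x,z)\in E(\vec{G}_i)$, i.e. both edges are oriented away from $x$ in $\vec{G}_i$. The orientation covering number $\sigma(G)$ is the smallest positive integer $k$ such that there is a list of $k$ orientations of $G$ forming an orientation covering of $G$. *)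

(* Defs.v *)
From mathcomp Require Import all_boot.

Set Implicit Arguments.
Unset Strict Implicit.
Unset Printing Implicit Defensive.

Record sgraph := SGraph {
  vertex :> finType;
  edge : rel vertex;
  edge_sym : symmetric edge;
  edge_irrefl : irreflexive edge }.

Section Complete.
Variable m : nat.

Definition complete_edge : rel 'I_m := fun x y => x != y.

Lemma complete_edge_sym : symmetric complete_edge.
Proof. by move=> x y; rewrite /complete_edge eq_sym. Qed.

Lemma complete_edge_irrefl : irreflexive complete_edge.
Proof. by move=> x; rewrite /complete_edge eqxx. Qed.

Definition complete : sgraph :=
  SGraph complete_edge_sym complete_edge_irrefl.
End Complete.

Section Colouring.
Variable G : sgraph.

Definition proper_colouring k (c : {ffun G -> 'I_k}) : bool :=
  [forall x : G, forall y : G, edge x y ==> (c x != c y)].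

Definition colourable (k : nat) : bool :=
  [exists c : {ffun G -> 'I_k}, proper_colouring c].

Lemma ex_colourable : exists k, colourable k.
Proof.
exists #|G|; apply/existsP; exists [ffun x => enum_rank x].
apply/forallP=> x; apply/forallP=> y; apply/implyP=> exy.
rewrite !ffunE (inj_eq enum_rank_inj); apply: contraTneq exy => ->.
by rewrite edge_irrefl.
Qed.

Definition chromatic_number : nat := ex_minn ex_colourable.
End Colouring.

Section OrientationCovering.
Variable G : sgraph.

(* An orientation is the set of its arcs; (x, y) is the arc from x to y. *)
Definition is_orientation (D : {set G * G}) : bool :=
  [forall x : G, forall y : G,
    if edge x y then ((x, y) \in D) (+) ((y, x) \in D)
    else (x, y) \notin D].

Definition orientation_covering k (D : {ffun 'I_k -> {set G * G}}) : bool :=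
  [forall i, is_orientation (D i)] &&
  [forall x : G, forall y : G, forall z : G,
    edge x y && edge x z ==>
    [exists i, ((x, y) \in D i) && ((x, z) \in D i)]].

Definition has_orientation_covering (k : nat) : bool :=
  (0 < k) &&
  [exists D : {ffun 'I_k -> {set G * G}}, orientation_covering D].

(* Witness: the i-th orientation follows the linear order on the vertices
   obtained from the enumeration of G by moving its i-th vertex to the front. *)
Lemma ex_orientation_covering : exists k, has_orientation_covering k.
Proof.
pose r (x : G) : nat := enum_rank x.
have r_inj : injective r by move=> x y /ord_inj /enum_rank_inj.
exists #|G|.+1; apply/andP; split=> //; apply/existsP.
exists [ffun i : 'I_(#|G|.+1) => [set p : G * G | edge p.1 p.2 &&
  ((r p.1 == i) || (r p.2 != i) && (r p.1 < r p.2))]].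
apply/andP; split.
  apply/forallP=> i; apply/forallP=> x; apply/forallP=> y.
  rewrite !ffunE !inE /= (edge_sym y x).
  have [exy|] //= := boolP (edge x y).
  have: r x != r y.
    by rewrite (inj_eq r_inj); apply: contraTneq exy => ->; rewrite edge_irrefl.
  have [->|_] := eqVneq (r x) i; first by rewrite eq_sym => /negbTE->.
  by have [->|_] := eqVneq (r y) i => //=; case: ltngtP.
apply/forallP=> x; apply/forallP=> y; apply/forallP=> z.
apply/implyP=> /andP[exy exz]; apply/existsP; exists (inord (r x)).
by rewrite !ffunE !inE /= exy exz inordK ?eqxx //= ltnS ltnW // ltn_ord.
Qed.

Definition orientation_covering_number : nat := ex_minn ex_orientation_covering.
End OrientationCovering.

(* Main.v *)
(* Given an orientation covering D_1, ..., D_k of G, put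
   A(x, y) = {i | (x, y) is an arc of D_i}.  The covering property says that
   {A(x, y) | y adjacent to x} is an intersecting family, which extends to a
   maximal one M_x, containing exactly one of each pair of complementary sets.
   As A(y, x) is the complement of A(x, y), adjacent vertices x and y have
   M_x <> M_y: this is a proper colouring of G by the maximal intersecting
   families on k points.  Conversely such a colouring M yields k orientations:
   pick A(x, y) in M_x but not in M_y, so that its complement is in M_y.
   Hence whether G has an orientation covering of size k depends only on k and
   on the chromatic number of G, and K_m has chromatic number m. *)
Require Import Defs.
From mathcomp Require Import all_boot.

Set Implicit Arguments.
Unset Strict Implicit.
Unset Printing Implicit Defensive.

Section IntersectingFamilies.
Variable T : finType.
Implicit Types (A B : {set T}) (F : {set {set T}}).

Definition intersecting F :=
  [forall A in F, forall B in F, A :&: B != set0].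

Definition maximal_intersecting F :=
  intersecting F && [forall A, (A \in F) || (~: A \in F)].

Lemma intersectingP F :
  reflect {in F &, forall A B, A :&: B != set0} (intersecting F).
Proof.
apply: (iffP forall_inP) => [FI A B AF BF | FI A AF].
  exact: (forall_inP (FI A AF)).
by apply/forall_inP => B BF; apply: FI.
Qed.

Lemma maximal_intersectingC F A :
  maximal_intersecting F -> (~: A \in F) = (A \notin F).
Proof.
case/andP=> /intersectingP FI /forallP/(_ A).
have [AF _ | //] := boolP (A \in F).
by apply/negP => /(FI _ _ AF); rewrite setICr eqxx.
Qed.

Lemma intersectingU1 A F :
    intersecting F -> A != set0 -> (forall B, B \in F -> A :&: B != set0) ->
  intersecting (A |: F).
Proof.
move=> /intersectingP FI A0 AF; apply/intersectingP => B C /setU1P[->|BF].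
  by case/setU1P=> [->|/AF//]; rewrite setIid.
by case/setU1P=> [->|]; [rewrite setIC AF | apply: FI].
Qed.

(** Take [M] inclusion-maximal among intersecting families above [F]. If it missed both [A] and
    [~: A], each would be disjoint from some member of [M], and these two members would be disjoint
    from each other. *)
Lemma intersecting_extension F : 0 < #|T| -> intersecting F ->
  exists2 M, maximal_intersecting M & F \subset M.
Proof.
move=> T0 /maxset_exists[M /maxsetP[MI maxM] FM]; exists M => //.
have key A : A != set0 -> A \notin M -> exists2 B, B \in M & B \subset ~: A.
  move=> A0 AM; case: (pickP [pred B in M | A :&: B == set0]).
    move=> B /= /andP[BM dis]; exists B => //.
    by rewrite subsets_disjoint setCK -setI_eq0 setIC.
  move=> no; case/negP: AM.
  (* If [A] met every member of [M], then [A |: M] would be intersecting, hence equal to [M]. *)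
  rewrite -(maxM (A |: M)) ?setU11 ?subsetUr //.
  apply: intersectingU1 => // B BM.
  by have /= := no B; rewrite BM => /negbT.
(* Since [key] excludes the empty set, this settles the cases where [A] or [~: A] is empty; it rests
   on [T] being inhabited. *)
have MT : setT \in M.
  have [//|nTM] := boolP (setT \in M).
  have [|B BM] := key setT _ nTM; first by rewrite -card_gt0 cardsT.
  rewrite setCT subset0 => /eqP B0.
  by have := intersectingP _ MI _ _ BM BM; rewrite B0 setI0 eqxx.
rewrite /maximal_intersecting MI; apply/forallP => A.
apply: contraT; rewrite negb_or => /andP[AM CAM].
have [|B BM sBA] := key A _ AM.
  by apply: contraNneq CAM => ->; rewrite setC0.
have [|C CM sCA] := key (~: A) _ CAM.
  by apply: contraNneq AM => A0; rewrite -(setCK A) A0 setC0.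
have := intersectingP _ MI _ _ BM CM.
by rewrite -subset0 -(setICr (~: A)) setISS.
Qed.

(* Where F and F' differ; symmetric in F and F', and only meaningful when
   F <> F'. *)
Definition separator F F' : {set T} :=
  odflt set0 [pick A | (A \in F) != (A \in F')].

Lemma separatorC F F' : separator F F' = separator F' F.
Proof.
by rewrite /separator; congr odflt; apply: eq_pick => A; rewrite eq_sym.
Qed.

Lemma separatorP F F' :
  F != F' -> (separator F F' \in F) != (separator F F' \in F').
Proof.
rewrite /separator; case: pickP => //= eqFF' /eqP[].
by apply/setP => A; apply/eqP; rewrite -[_ == _]negbK eqFF'.
Qed.

(* The member of F among the separator and its complement. *)
Definition side F F' : {set T} :=
  [set i | (i \in separator F F') == (separator F F' \in F)].

Lemma side_in F F' : maximal_intersecting F -> side F F' \in F.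
Proof.
move=> Fmax; rewrite /side; set A := separator F F'.
have [AF | AF] := boolP (A \in F).
  suff -> : [set i | (i \in A) == true] = A by [].
  by apply/setP => i; rewrite inE eqb_id.
suff -> : [set i | (i \in A) == false] = ~: A.
  by rewrite maximal_intersectingC.
by apply/setP => i; rewrite !inE eqbF_neg.
Qed.

(** Both sides are cut from one separator, which lies in exactly one of the two families, so they
    are complementary. *)
Lemma sideC i F F' : F != F' -> (i \in side F F') (+) (i \in side F' F).
Proof.
move=> /separatorP; rewrite !inE (separatorC F').
by case: (i \in _) (_ \in F) (_ \in F') => [] [] [].
Qed.

End IntersectingFamilies.

Lemma properP (G : sgraph) k (c : {ffun G -> 'I_k}) :
  reflect (forall x y, edge x y -> c x != c y) (proper_colouring c).
Proof.
apply: (iffP forallP) => [cP x y | cP x].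
  by move: (cP x) => /forallP/(_ y)/implyP.
by apply/forallP => y; apply/implyP/cP.
Qed.

Lemma colourable_setP (G : sgraph) (T : finType) (U : {set T}) :
  reflect (exists2 f : G -> T, forall x, f x \in U &
             forall x y, edge x y -> f x != f y)
          (colourable G #|U|).
Proof.
apply: (iffP existsP) => [[c /properP cP] | [f fU fP]].
  exists (fun x => enum_val (c x)) => [x | x y /cP]; first exact: enum_valP.
  by rewrite (inj_eq enum_val_inj).
(* Each vertex supplies its own witness that [U] is inhabited; [enum_val] inverts the rank whatever
   the witness. *)
exists [ffun x => enum_rank_in (fU x) (f x)]; apply/properP => x y /fP.
rewrite !ffunE; apply: contraNneq => /(congr1 enum_val).
by rewrite !enum_rankK_in // => ->.
Qed.

Lemma colourable_leq (G : sgraph) n : colourable G n = (chromatic_number G <= n).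
Proof.
rewrite /chromatic_number; case: ex_minnP => m mcol mmin.
apply/idP/idP => [/mmin // | le_mn].
have /existsP[c /properP cP] := mcol.
apply/existsP; exists [ffun x => widen_ord le_mn (c x)].
by apply/properP => x y /cP; rewrite !ffunE.
Qed.

Lemma chromatic_number_complete m : chromatic_number (complete m) = m.
Proof.
rewrite /chromatic_number; case: ex_minnP => n /existsP[c /properP cP] nmin.
apply/eqP; rewrite eqn_leq nmin /=.
  (* Distinct vertices are adjacent, so a proper colouring is injective. *)
  have c_inj : injective c.
    by move=> x y cxy; apply: contraTeq isT => /cP; rewrite cxy eqxx.
  by have := leq_card c c_inj; rewrite !card_ord.
apply/existsP; exists [ffun x => x]; apply/properP => x y.
by rewrite !ffunE.
Qed.

Section OrientationCovering.
Variable G : sgraph.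

Lemma orientationP (D : {set G * G}) :
  reflect [/\ forall x y, edge x y -> ((x, y) \in D) (+) ((y, x) \in D)
            & forall x y, (x, y) \in D -> edge x y]
          (is_orientation D).
Proof.
apply: (iffP forallP) => [DP | [D1 D2] x].
  by split=> x y; have /forallP/(_ y) := DP x; case: edge => // /negP.
apply/forallP => y; case: ifPn => [/D1 // | ].
by apply: contraNN => /D2.
Qed.

Lemma orientation_coveringP k (D : {ffun 'I_k -> {set G * G}}) :
  reflect [/\ forall i, is_orientation (D i)
            & forall x y z, edge x y -> edge x z ->
                exists i, ((x, y) \in D i) && ((x, z) \in D i)]
          (orientation_covering D).
Proof.
apply: (iffP andP) => [[/forallP D1 /forallP D2] | [D1 D2]].
  split=> // x y z exy exz; apply/existsP.
  have /forallP/(_ y)/forallP/(_ z) := D2 x.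
  by rewrite exy exz.
split; first exact/forallP.
apply/forallP => x; apply/forallP => y; apply/forallP => z.
by apply/implyP => /andP[exy exz]; apply/existsP/D2.
Qed.

Definition arc_set k (D : {ffun 'I_k -> {set G * G}}) x y : {set 'I_k} :=
  [set i | (x, y) \in D i].

Lemma covering_colourable k (D : {ffun 'I_k -> {set G * G}}) :
    0 < k -> orientation_covering D ->
  colourable G #|[set F : {set {set 'I_k}} | maximal_intersecting F]|.
Proof.
move=> k0 /orientation_coveringP[Dor Dcov].
pose N x := [set arc_set D x y | y in edge x].
have NI x : intersecting (N x).
  apply/intersectingP => _ _ /imsetP[y exy ->] /imsetP[z exz ->].
  have [i iP] := Dcov x y z exy exz.
  by apply/set0Pn; exists i; rewrite !inE.
(* A boolean existential lets [xchoose] select one family per vertex. *)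
have ext x : exists M, maximal_intersecting M && (N x \subset M).
  have [|M Mmax NM] := intersecting_extension _ (NI x).
    by rewrite card_ord.
  by exists M; rewrite Mmax.
apply/colourable_setP; exists (fun x => xchoose (ext x)) => [x | x y exy].
  by rewrite inE; case/andP: (xchooseP (ext x)).
have /andP[_ /subsetP Nx] := xchooseP (ext x).
have /andP[My /subsetP Ny] := xchooseP (ext y).
have Axy : arc_set D x y \in xchoose (ext x) by apply/Nx/imset_f.
have : arc_set D y x \in xchoose (ext y).
  by apply/Ny/imset_f; rewrite -topredE /= edge_sym.
have -> : arc_set D y x = ~: arc_set D x y.
  apply/setP => i; rewrite !inE.
  have /orientationP[/(_ x y exy) + _] := Dor i.
  by do 2!case: (_ \in _).
by rewrite maximal_intersectingC //; apply: contraNneq => <-.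
Qed.

Lemma colourable_covering k :
    colourable G #|[set F : {set {set 'I_k}} | maximal_intersecting F]| ->
  exists D : {ffun 'I_k -> {set G * G}}, orientation_covering D.
Proof.
case/colourable_setP=> f fmax fP.
pose D := [ffun i : 'I_k =>
  [set p : G * G | edge p.1 p.2 && (i \in side (f p.1) (f p.2))]].
have DE i x y : ((x, y) \in D i) = edge x y && (i \in side (f x) (f y)).
  by rewrite ffunE inE.
have {}fmax x : maximal_intersecting (f x) by have := fmax x; rewrite inE.
exists D; apply/orientation_coveringP; split=> [i | x y z exy exz].
  apply/orientationP; split=> x y; rewrite !DE; last by case/andP.
  by move=> exy; rewrite (edge_sym y) exy; apply/sideC/fP.
(* The sides of [f x] against [f y] and [f z] both belong to [f x], so they share an index. *)
have /andP[/intersectingP fI _] := fmax x.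
have /set0Pn[i] := fI _ _ (side_in (f y) (fmax x)) (side_in (f z) (fmax x)).
by case/setIP=> iy iz; exists i; rewrite !DE exy exz iy.
Qed.

Lemma has_orientation_coveringE k :
  has_orientation_covering G k =
  (0 < k) && (chromatic_number G <=
    #|[set F : {set {set 'I_k}} | maximal_intersecting F]|).
Proof.
rewrite /has_orientation_covering -colourable_leq.
have [k0 /= | //] := boolP (0 < k).
apply/existsP/idP => [[D] | ]; last exact: colourable_covering.
exact: covering_colourable.
Qed.

End OrientationCovering.

Theorem theorem1 (G : sgraph) (hG : 0 < #|G|) :
  orientation_covering_number G =
  orientation_covering_number (complete (chromatic_number G)).
Proof.
(* Both numbers are least elements of predicates that agree at every [k]. *)
apply: eq_ex_minn => k.
by rewrite !has_orientation_coveringE chromatic_number_complete.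
Qed.
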